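(* Let $N,n$ be integers with $3\le n\le N$. (A) A marked difference $D\in m\mathbf{D}_N^n$ is a periodic point of the self-map $Def$ of $m\mathbf{D}_N^n$ (that is, $D\in Per(\mathbf{Def}_N^n)$) if and only if it satisfies the following two conditions: (A.1) $w(D)\le 1$; (A.2) $D$ is max-marked. (B) A marked rhythm $A\in m\mathbf{R}_N^n$ is quasi-smooth if and only if its difference $\Delta(A)$ satisfies the two conditions (A.1) and (A.2), i.e. $w(\Delta(A))\le 1$ and $\Delta(A)$ is max-marked.
   Context: Let $N,n$ be integers with $3\le n\le N$. For an integer $m\ge 3$ let $\mathbf{Z}_m=\{0,1,\dots,m-1\}$, let $R_m:\mathbf{Z}\to\mathbf{Z}_m$ be the least nonnegative remainder modulo $m$, and put $a+_mb=R_m(a+b)$, $a-_mb=R_m(a-b)$ for $a,b\in\mathbf{Z}_m$. Rhythms: $\mathbf{R}_N^n$ is the set of $n$-tuples $a=(a_0,\dots,a_{n-1})\in\mathbf{Z}_N^n$ of mutually distinct elements with $\sum_{k=0}^{n-1}(a_k-_Na_{k-_n1})=N$ (the sum being taken in $\mathbf{Z}$). Marked rhythms: $m\mathbf{R}_N^n=\mathbf{Z}_n\times\mathbf{R}_N^n$. Differences: $\mathbf{D}_N^n$ is the set of $(d_0,\dots,d_{n-1})\in(\mathbf{Z}_N\setminus\{0\})^n$ with $\sum_{k=0}^{n-1}d_k=N$ (sum in $\mathbf{Z}$). Marked differences: $m\mathbf{D}_N^n=\mathbf{Z}_n\times\mathbf{D}_N^n$; for $D=(k,d)\in m\mathbf{D}_N^n$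 the element $k$ is the marker, $d$ the difference part, and $d_k$ the marked entry. For $a\in\mathbf{R}_N^n$ put $d(a)=(a_0-_Na_{n-1},a_1-_Na_0,\dots,a_{n-1}-_Na_{n-2})\in\mathbf{D}_N^n$, and $\Delta:m\mathbf{R}_N^n\to m\mathbf{D}_N^n$, $\Delta(k,a)=(k,d(a))$. Discrete average: $rav_N(a,b)=a+_N\lfloor (b-_Na)/2\rfloor$ for $a,b\in\mathbf{Z}_N$. Reformation map $Ref:m\mathbf{R}_N^n\to m\mathbf{R}_N^n$: $Ref(k,a)=(k+_n1,b)$, where $b_k=rav_N(a_{k-_n1},a_{k+_n1})$ and $b_i=a_i$ for $i\ne k$. Deformation map $Def:m\mathbf{D}_N^n\to m\mathbf{D}_N^n$: $Def(k,d)=(k+_n1,e)$, where $e_k=\lfloor (d_k+_Nd_{k+_n1})/2\rfloor$, $e_{k+_n1}=\lceil (d_k+_Nd_{k+_n1})/2\rceil$, and $e_i=d_i$ for $i\notin\{k,k+_n1\}$. $\mathbf{Ref}_N^n=(m\mathbf{R}_N^n,Ref)$ and $\mathbf{Def}_N^n=(m\mathbf{D}_N^n,Def)$. For a finite dynamical system $\mathbf{F}=(X,F)$, $Per(\mathbf{F})=\{x\in X: F^m(x)=x\text{ for some positive integer }m\}$. A marked rhythm $A$ is quasi-smooth if $A\in Per(\mathbf{Ref}_N^n)$. The width $w(d)$ of $d\in\mathbf{D}_N^n$ is the maximum minus the minimum of its entries, and $w(k,d)=w(d)$. $D=(k,d)$ is max-marked if $d_k=\max_i d_i$. *)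

(* Defs.v *)
From mathcomp Require Import all_boot.
From mathcomp Require Import zify.

Set Implicit Arguments.
Unset Strict Implicit.
Unset Printing Implicit Defensive.

(* Z_m is 'I_m; on Z_n, k +_n 1 is [ordS k] and k -_n 1 is [ord_pred k]. *)

Section ModularOperations.
Variable m : nat.
Implicit Types a b : 'I_m.

Fact modop_subproof a x : x %% m < m.
Proof. by rewrite ltn_mod (leq_trans _ (ltn_ord a)). Qed.

Definition addm a b : 'I_m := Ordinal (modop_subproof a (a + b)).

(* Since b < m, the truncated subtraction m - b is exact. *)
Definition subm a b : 'I_m := Ordinal (modop_subproof a (a + (m - b))).

Fact floor_half_subproof a : a./2 < m.
Proof. by have := ltn_ord a; lia. Qed.
Definition floor_half a : 'I_m := Ordinal (floor_half_subproof a).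

Fact ceil_half_subproof a : uphalf a < m.
Proof. by have := ltn_ord a; lia. Qed.
Definition ceil_half a : 'I_m := Ordinal (ceil_half_subproof a).

Lemma floor_halfE a : floor_half a = a./2 :> nat. Proof. by []. Qed.

Lemma ceil_halfE a : ceil_half a = uphalf a :> nat. Proof. by []. Qed.

Lemma addmE a b : addm a b = (if a + b < m then a + b else a + b - m) :> nat.
Proof.
rewrite /=; case: ltnP => h; first by rewrite modn_small.
have := ltn_ord a; have := ltn_ord b => hb ha.
by rewrite -{1}(subnK h) modnDr modn_small //; lia.
Qed.

Lemma submE a b : subm a b = (if b <= a then a - b else a + m - b) :> nat.
Proof.
rewrite /=; have := ltn_ord a; have := ltn_ord b => hb ha.
case: leqP => h; last by rewrite modn_small; lia.
have -> : a + (m - b) = a - b + m by lia.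
by rewrite modnDr modn_small //; lia.
Qed.

End ModularOperations.

Section RhythmsAndDifferences.
Variables N n : nat.
Implicit Types a d : {ffun 'I_n -> 'I_N}.

Definition is_rhythm a : bool :=
  injectiveb a && (\sum_(k < n) subm (a k) (a (ord_pred k)) == N).

Definition is_difference d : bool :=
  [forall k, (d k : nat) != 0] && (\sum_(k < n) d k == N).

Definition rhythm : Type := {a : {ffun 'I_n -> 'I_N} | is_rhythm a}.
Definition marked_rhythm : Type := ('I_n * rhythm)%type.

Definition difference : Type := {d : {ffun 'I_n -> 'I_N} | is_difference d}.
Definition marked_difference : Type := ('I_n * difference)%type.

Definition diff_fun a : {ffun 'I_n -> 'I_N} :=
  [ffun k => subm (a k) (a (ord_pred k))].

Definition rav (x y : 'I_N) : 'I_N := addm x (floor_half (subm y x)).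

Definition ref_fun (k : 'I_n) a : {ffun 'I_n -> 'I_N} :=
  [ffun i => if i == k then rav (a (ord_pred k)) (a (ordS k)) else a i].

Definition def_fun (k : 'I_n) d : {ffun 'I_n -> 'I_N} :=
  [ffun i => if i == k then floor_half (addm (d k) (d (ordS k)))
             else if i == ordS k then ceil_half (addm (d k) (d (ordS k)))
             else d i].

End RhythmsAndDifferences.

Section WellDefined.
Variables N n : nat.
Hypothesis n_ge3 : 3 <= n.
Implicit Types a d : {ffun 'I_n -> 'I_N}.

Lemma ordSE (k : 'I_n) : ordS k = (if k.+1 == n then 0 else k.+1) :> nat.
Proof.
have := ltn_ord k; rewrite /= => hk.
by case: eqP => [->|h]; [rewrite modnn | rewrite modn_small; lia].
Qed.

Lemma ordS_neq (k : 'I_n) : ordS k != k.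
Proof.
apply/eqP => /(congr1 (@nat_of_ord n)); rewrite ordSE.
by case: eqP => /=; lia.
Qed.

Lemma ordSS_neq (k : 'I_n) : ordS (ordS k) != k.
Proof.
apply/eqP => /(congr1 (@nat_of_ord n)); rewrite !ordSE.
by case: (k.+1 =P n) => /=; case: eqP => /=; lia.
Qed.

Lemma ord_pred_neq (k : 'I_n) : ord_pred k != k.
Proof. by rewrite -(inj_eq (@ordS_inj n)) ord_predK eq_sym ordS_neq. Qed.

Lemma ord_pred_neqS (k : 'I_n) : ord_pred k != ordS k.
Proof. by rewrite -(inj_eq (@ordS_inj n)) ord_predK eq_sym ordSS_neq. Qed.

Lemma is_differenceP d :
  reflect ((forall k, 0 < d k) /\ \sum_(k < n) d k = N) (is_difference d).
Proof.
apply: (iffP andP) => [[/forallP h /eqP s]|[h s]]; split=> //.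
- by move=> k; rewrite lt0n.
- by apply/forallP => k; rewrite -lt0n.
- exact/eqP.
Qed.

Lemma difference_lt d k : is_difference d -> d k + d (ordS k) < N.
Proof.
case/is_differenceP => pos s.
suff: d k + d (ordS k) < \sum_(i < n) d i by rewrite s.
rewrite (bigD1 k) //= (bigD1 (ordS k)) ?ordS_neq //=.
rewrite (bigD1 (ordS (ordS k))) /=; last by rewrite ordSS_neq ordS_neq.
by have := pos (ordS (ordS k)); lia.
Qed.

Lemma def_subproof k d : is_difference d -> is_difference (def_fun k d).
Proof.
move=> hd; have lt := difference_lt k hd.
have sE : addm (d k) (d (ordS k)) = d k + d (ordS k) :> nat by rewrite addmE lt.
case/is_differenceP: hd => pos s; apply/is_differenceP; split.
  move=> i; rewrite ffunE; have := pos k; have := pos (ordS k) => p1 p2.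
  case: eqP => _; first by rewrite floor_halfE sE; lia.
  by case: eqP => _ //; rewrite ceil_halfE sE; lia.
apply: (etrans _ s); rewrite [LHS](bigD1 k) //= [RHS](bigD1 k) //=.
rewrite [X in _ + X](bigD1 (ordS k)) ?ordS_neq //=.
rewrite [X in _ = _ + X](bigD1 (ordS k)) ?ordS_neq //=.
rewrite !ffunE eqxx (negPf (ordS_neq k)) eqxx.
set S1 := (X in _ + (_ + X) = _); set S2 := (X in _ = _ + (_ + X)).
have -> : S1 = S2.
  by apply: eq_bigr => i /andP[/negPf ik /negPf iSk]; rewrite ffunE ik iSk.
rewrite floor_halfE ceil_halfE sE; lia.
Qed.

Lemma diff_subproof a : is_rhythm a -> is_difference (diff_fun a).
Proof.
case/andP=> /injectiveP inj /eqP s; apply/is_differenceP; split.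
  move=> k; rewrite ffunE submE.
  have /eqP : a k != a (ord_pred k) by rewrite inj_eq // eq_sym ord_pred_neq.
  move=> ne0; have ne : nat_of_ord (a k) <> a (ord_pred k).
    by move=> e; apply: ne0; apply: val_inj.
  move: ne (ltn_ord (a k)) (ltn_ord (a (ord_pred k))).
  move: (nat_of_ord (a k)) (nat_of_ord (a (ord_pred k))) => x y; case: (leqP y x); lia.
by rewrite -[RHS]s; apply: eq_bigr => k _; rewrite ffunE.
Qed.

Lemma rhythm_of_diff a : is_difference (diff_fun a) -> is_rhythm a.
Proof.
case/is_differenceP=> pos s; apply/andP; split; last first.
  by rewrite -[X in _ == X]s; apply/eqP/eq_bigr => k _; rewrite ffunE.
pose S (i j : nat) := \sum_(l < n | i < l <= j) diff_fun a l.
have aS (i : 'I_n) t (lt : i + t < n) :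
    (a i + S i (i + t)) %% N = a (Ordinal lt).
  elim: t lt => [|t IH] lt.
    rewrite /S big_pred0 => [|l]; last by lia.
    rewrite addn0 modn_small //; congr (nat_of_ord (a _)).
    by apply: val_inj; rewrite /= addn0.
  have lt' : i + t < n by lia.
  rewrite /S (bigD1 (Ordinal lt)) /=; last by lia.
  rewrite (eq_bigl (fun l : 'I_n => i < l <= i + t)) => [|l]; last first.
    by rewrite -val_eqE /=; lia.
  rewrite -/(S i (i + t)) addnCA -modnDmr (IH lt') ffunE.
  have -> : ord_pred (Ordinal lt) = Ordinal lt'.
    apply: (@ordS_inj n); rewrite ord_predK; apply: val_inj.
    by rewrite /= modn_small; lia.
  rewrite submE; set x := a _; set y := a _.
  have := ltn_ord x; have := ltn_ord y => hy hx.
  case: leqP => h; first by rewrite subnK // modn_small.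
  by rewrite subnK; [rewrite modnDr modn_small | lia].
have key (i j : 'I_n) : i < j -> a i <> a j.
  move=> ij e; have lt : i + (j - i) < n by have := ltn_ord j; lia.
  have := aS i _ lt.
  have -> : Ordinal lt = j by apply: val_inj => /=; lia.
  rewrite -e; have -> : i + (j - i) = j by lia.
  have Spos : 0 < S i j.
    rewrite /S (bigD1 j) /=; last by rewrite ij leqnn.
    by have := pos j; lia.
  have Slt : S i j < N.
    suff: S i j < \sum_(l < n) diff_fun a l by rewrite s.
    rewrite (bigID (fun l : 'I_n => i < l <= j)) /= -/(S i j).
    rewrite (bigD1 i) /=; last by rewrite ltnn.
    by have := pos i; lia.
  have ai := ltn_ord (a i); case: (ltnP (a i + S i j) N) => h.
    by rewrite modn_small; lia.
  by rewrite -{1}(subnK h) modnDr modn_small; lia.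
apply/injectiveP => i j e; apply: val_inj.
by case: (ltngtP i j) => // /key; rewrite e.
Qed.

Lemma diff_ref k a :
  is_rhythm a -> diff_fun (ref_fun k a) = def_fun k (diff_fun a).
Proof.
move=> ha; have := difference_lt k (diff_subproof ha).
rewrite !ffunE ordSK => lt.
have ltx := ltn_ord (a (ord_pred k)); have lty := ltn_ord (a k).
have ltz := ltn_ord (a (ordS k)).
have sE : subm (a (ordS k)) (a (ord_pred k))
    = addm (subm (a k) (a (ord_pred k))) (subm (a (ordS k)) (a k)).
  apply: val_inj; rewrite [val _]submE [val _]addmE lt !submE.
  move: lt; rewrite !submE; move: ltx lty ltz.
  move: (nat_of_ord (a k)) (nat_of_ord (a (ordS k))) => y z.
  move: (nat_of_ord (a (ord_pred k))) => x.
  by case: (leqP x y); case: (leqP y z); case: (leqP x z); lia.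
apply/ffunP => i; rewrite !ffunE; case: (eqVneq i k) => [->|ik].
  rewrite (negPf (ord_pred_neq k)) ordSK -sE /rav.
  set x := a (ord_pred k); set u := floor_half _.
  apply: val_inj; rewrite [val _]submE !addmE -[val u]/(nat_of_ord u).
  have := ltn_ord u; have := ltn_ord x.
  move: (nat_of_ord u) (nat_of_ord x) => v y hy hv.
  by case: (ltnP (y + v) N) => h; [case: (leqP y) | case: (leqP y)]; lia.
case: (eqVneq i (ordS k)) => [->|iSk].
  rewrite ordSK eqxx -sE /rav.
  have sv : subm (a (ordS k)) (a (ord_pred k)) =
    (if a (ord_pred k) <= a (ordS k) then a (ordS k) - a (ord_pred k)
     else a (ordS k) + N - a (ord_pred k)) :> nat by rewrite submE.
  move: sv; set u := subm _ _ => sv.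
  apply: val_inj; rewrite [val _]submE !addmE.
  rewrite floor_halfE [val _]ceil_halfE.
  move: ltx lty ltz sv (ltn_ord u).
  set x := nat_of_ord (a (ord_pred k)); set z := nat_of_ord (a (ordS k)).
  set v := nat_of_ord u.
  case: (leqP x z) => h; case: (ltnP (x + v./2) N) => h2.
  - by case: (leqP (x + v./2) z); lia.
  - by case: (leqP (x + v./2 - N) z); lia.
  - by case: (leqP (x + v./2) z); lia.
  - by case: (leqP (x + v./2 - N) z); lia.
case: (ord_pred i =P k) => // e.
by case/eqP: iSk; rewrite -e ord_predK.
Qed.

Lemma ref_subproof k a : is_rhythm a -> is_rhythm (ref_fun k a).
Proof.
move=> ha; apply: rhythm_of_diff; rewrite diff_ref //.
exact/def_subproof/diff_subproof.
Qed.

Definition Delta (A : marked_rhythm N n) : marked_difference N n :=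
  (A.1, exist _ (diff_fun (val A.2)) (diff_subproof (valP A.2))).

Definition Ref (A : marked_rhythm N n) : marked_rhythm N n :=
  (ordS A.1, exist _ (ref_fun A.1 (val A.2)) (ref_subproof A.1 (valP A.2))).

Definition Def (D : marked_difference N n) : marked_difference N n :=
  (ordS D.1, exist _ (def_fun D.1 (val D.2)) (def_subproof D.1 (valP D.2))).

End WellDefined.

Definition Per (X : Type) (F : X -> X) (x : X) : Prop :=
  exists m : nat, 0 < m /\ iter m F x = x.

Definition quasi_smooth (N n : nat) (n_ge3 : 3 <= n) (A : marked_rhythm N n) :=
  Per (Ref n_ge3) A.

Section Width.
Variables N n : nat.
Implicit Type D : marked_difference N n.

Definition max_entry (d : difference N n) : nat := \max_(i < n) val d i.

(* All entries are < N, so for n > 0 the neutral element N does not affect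
   the minimum. *)
Definition min_entry (d : difference N n) : nat :=
  \big[minn/N]_(i < n) val d i.

Definition width D : nat := max_entry D.2 - min_entry D.2.

Definition max_marked D : Prop := val D.2 D.1 = max_entry D.2 :> nat.

End Width.

(* Main.v *)
(** Periodicity forces every nonincreasing potential to be constant along the
  orbit. Applied to the sum of the squared entries, this shows that the two
  averaged entries of a periodic marked difference differ by at most one, so
  that [Def] merely sorts them; the marked entry is then nondecreasing, hence
  constant, and it carries a maximum around the circle past all the other
  entries. Conversely, where (A.1) and (A.2) hold, [Def] swaps the marked entry
  with the next one, and [Ref] replaces [a_k] by [a_(k-1) + a_(k+1) - a_k].
  Both formulas define injective self-maps of a finite set, all of whose points
  are periodic. *)

Require Import Defs.
From mathcomp Require Import all_boot perm.
From mathcomp Require Import zify.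

Set Implicit Arguments.
Unset Strict Implicit.
Unset Printing Implicit Defensive.

Section Periodicity.
Variables (X : Type) (F : X -> X).

Lemma Per_step x : Per F x -> Per F (F x).
Proof. by case=> m [m0 e]; exists m; rewrite -iterSr iterS e. Qed.

(** The orbit of [F x] returns to [x], so descending along it bounds [phi x] by [phi (F x)]. Descent
    is asked only at periodic points, so it may rest on facts already drawn from periodicity. *)
Lemma Per_potential (phi : X -> nat) x :
  (forall y, Per F y -> phi (F y) <= phi y) -> Per F x -> phi (F x) = phi x.
Proof.
move=> dec px; apply/eqP; rewrite eqn_leq dec //=.
have perI j : Per F (iter j F (F x)).
  by elim: j => [|j IH] /=; apply: Per_step.
have decI j : phi (iter j F (F x)) <= phi (F x).
  by elim: j => //= j; apply: leq_trans; apply: dec.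
by case: px => -[|m] [] // _ e; rewrite -{1}e iterSr.
Qed.

Lemma Per_conj (Y : Type) (G : Y -> Y) (h : X -> Y) x :
  (forall x, h (F x) = G (h x)) -> Per F x -> Per G (h x).
Proof.
move=> hF [m [m0 e]]; exists m; split=> //; rewrite -[in RHS]e.
by elim: m {m0 e} => //= m ->; rewrite hF.
Qed.

(** On the invariant set [P], [F] follows the injective map [G], whose orbits on a finite type close
    up; injectivity of [h] pulls the return back to [X]. *)
Lemma Per_inj (Y : finType) (G : Y -> Y) (h : X -> Y) (P : X -> Prop) x :
  injective G -> injective h ->
  (forall x, P x -> P (F x)) -> (forall x, P x -> h (F x) = G (h x)) ->
  P x -> Per F x.
Proof.
move=> injG injh PF hF Px; exists (order G (h x)); split; first exact: order_gt0.
apply: injh; rewrite -[RHS](iter_order injG).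
have PI j : P (iter j F x) by elim: j => //= j; apply: PF.
by elim: (order _ _) => //= m <-; apply: hF.
Qed.

End Periodicity.

Section ModularCancellation.
Variable m : nat.
Implicit Types a b : 'I_m.

Lemma addm_submK a b : addm a (subm b a) = b.
Proof.
apply: val_inj; rewrite [val _]addmE submE.
by have := ltn_ord a; have := ltn_ord b => /=; case: (leqP a b); case: ifP; lia.
Qed.

Lemma addm_injr a : injective (addm a).
Proof.
move=> b c /(congr1 val); rewrite ![val _]addmE => e; apply: val_inj.
move: e; have := ltn_ord a; have := ltn_ord b; have := ltn_ord c => /=.
by case: ifP; case: ifP; lia.
Qed.

Lemma subm_injr a : injective (subm a).
Proof.
move=> b c /(congr1 val); rewrite ![val _]submE => e; apply: val_inj.
move: e; have := ltn_ord a; have := ltn_ord b; have := ltn_ord c => /=.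
by case: ifP; case: ifP; lia.
Qed.

End ModularCancellation.

Lemma iter_ordS_surj n (k i : 'I_n) : exists j, iter j (@ordS n) k = i.
Proof.
have iterE j : iter j (@ordS n) k = (k + j) %% n :> nat.
  elim: j => [|j IH]; first by rewrite addn0 modn_small.
  by rewrite iterS /= IH -addn1 modnDml addn1 addnS.
exists (i + n - k); apply: val_inj; rewrite /= iterE.
have := ltn_ord i; have := ltn_ord k => hk hi.
by rewrite subnKC ?modnDr ?modn_small; lia.
Qed.

Lemma balanced_squares x y u v :
  u + v = x + y -> u <= v <= u.+1 ->
  u ^ 2 + v ^ 2 <= x ^ 2 + y ^ 2
  /\ (u ^ 2 + v ^ 2 = x ^ 2 + y ^ 2 -> x <= y.+1 /\ y <= x.+1).
Proof.
rewrite -!mulnn => e uv.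
have [xu|ux] := leqP x u.
  (* In these parameters the excess of [x ^ 2 + y ^ 2] is [2 * t * (t + b)], which vanishes only for
     [t = 0]. *)
  have [t [b [? ? ? ?]]] : exists t b,
      [/\ b <= 1, u = x + t, v = x + t + b & y = x + t + t + b].
    by exists (u - x), (v - u); split; lia.
  by subst; clear e uv xu; split; nia.
(* Here the excess is [2 * (t + 1) * (t + c)], which vanishes only for [t = c = 0]. *)
have [t [c [? ? ? ?]]] : exists t c,
    [/\ c <= 1, v = y + t + 1, u = y + t + c & x = y + t + t + 1 + c].
  by exists (x - u).-1, (u.+1 - v); split; lia.
by subst; clear e uv ux; split; nia.
Qed.

Section Differences.
Variables N n : nat.
Implicit Types D : marked_difference N n.

Definition entry D (i : 'I_n) : nat := val D.2 i.
Definition mark D : nat := entry D D.1.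
Definition next D : nat := entry D (ordS D.1).

(** Conditions (A.1) and (A.2) joined into one pointwise condition, usable at single indices. *)
Definition carries_max D : Prop := forall i, entry D i <= mark D <= (entry D i).+1.

Lemma min_entry_le D i : min_entry D.2 <= entry D i.
Proof.
rewrite /min_entry; have: i \in index_enum 'I_n by rewrite mem_index_enum.
elim: (index_enum _) => // j s IH; rewrite inE big_cons geq_min.
by case/orP=> [/eqP <-|/IH ->]; rewrite ?leqnn ?orbT.
Qed.

Lemma carries_maxP D : (width D <= 1 /\ max_marked D) <-> carries_max D.
Proof.
have leM i : entry D i <= max_entry D.2.
  exact: (bigmax_sup i).
split=> [[w mD] i|good].
  rewrite /mark {2 3}/entry mD leM /=.
  have := min_entry_le D i; move: w; rewrite /width; lia.
have mD : max_marked D.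
  apply/eqP; rewrite /max_marked eqn_leq leM /=; apply/bigmax_leqP => i _.
  by case/andP: (good i).
split=> //; rewrite /width -mD -/(entry D D.1) -/(mark D).
suff: (mark D).-1 <= min_entry D.2 by lia.
rewrite /min_entry; apply: (big_ind (fun x => (mark D).-1 <= x)) => [|x y hx hy|i _].
(* The default value [N] of the minimum exceeds every entry. *)
- by have := ltn_ord (val D.2 D.1); rewrite /mark /entry; lia.
- by rewrite leq_min hx.
- by have := good i; rewrite /entry; lia.
Qed.

Hypothesis hn : 3 <= n.

Lemma entry_Def D i :
  entry (Def hn D) i = if i == D.1 then (mark D + next D)./2
                       else if i == ordS D.1 then uphalf (mark D + next D)
                       else entry D i.
Proof.
have lt := difference_lt hn D.1 (valP D.2).
rewrite /entry /= ffunE; case: eqP => _; first by rewrite floor_halfE addmE lt.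
by case: eqP => _ //; rewrite ceil_halfE addmE lt.
Qed.

Lemma mark_Def D : mark (Def hn D) = uphalf (mark D + next D).
Proof. by rewrite {1}/mark entry_Def /= (negPf (ordS_neq hn _)) eqxx. Qed.

Lemma Per_balanced D : Per (Def hn) D -> mark D <= (next D).+1 /\ next D <= (mark D).+1.
Proof.
pose phi D := \sum_(i < n) entry D i ^ 2.
have phiE D' : phi D' =
  mark D' ^ 2 + (next D' ^ 2 + \sum_(i < n | (i != D'.1) && (i != ordS D'.1)) entry D' i ^ 2).
  by rewrite /phi (bigD1 D'.1) // (bigD1 (ordS D'.1)) ?ordS_neq.
have phiDefE D' : phi (Def hn D') =
  (mark D' + next D')./2 ^ 2 + (uphalf (mark D' + next D') ^ 2 +
    \sum_(i < n | (i != D'.1) && (i != ordS D'.1)) entry D' i ^ 2).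
  rewrite /phi (bigD1 D'.1) // (bigD1 (ordS D'.1)) ?ordS_neq //=.
  rewrite !entry_Def !eqxx (negPf (ordS_neq hn _)); congr (_ + (_ + _)).
  by apply: eq_bigr => i /andP[/negPf ik /negPf iSk]; rewrite entry_Def ik iSk.
have bal D' := @balanced_squares (mark D') (next D') (mark D' + next D')./2
  (uphalf (mark D' + next D')) ltac:(lia) ltac:(lia).
have le D' : phi (Def hn D') <= phi D'.
  by rewrite phiDefE phiE; have := (bal D').1; lia.
move=> /(Per_potential (fun D' _ => le D')); rewrite phiDefE phiE => e.
by apply: (bal D).2; lia.
Qed.

Lemma Per_next_le D : Per (Def hn) D -> next D <= mark D <= (next D).+1.
Proof.
move=> pD; have bal := Per_balanced pD.
have mlt D' : mark D' < N by apply: ltn_ord.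
(* Subtracting from [N] turns the nondecreasing mark into a nonincreasing potential; entries below
   [N] make the subtraction exact. *)
have/(_ D): forall D', Per (Def hn) D' -> N - mark (Def hn D') = N - mark D'.
  move=> D'; apply: (Per_potential (phi := fun D => N - mark D)) => E /Per_balanced.
  by rewrite mark_Def; lia.
move=> /(_ pD); have := mlt D; have := mlt (Def hn D); rewrite mark_Def; lia.
Qed.

Lemma Per_carries_max D : Per (Def hn) D -> carries_max D.
Proof.
move=> pD i; have [j <-] := iter_ordS_surj D.1 i.
elim: j D pD {i} => [|j IH] D pD; first by rewrite /= -/(mark D); lia.
have nx := Per_next_le pD; have := IH _ (Per_step pD).
(* Seen from [Def hn D], whose marker is one step further on, the position is only [j] steps away;
   by [nx] the mark is unchanged. *)
rewrite -iterSr; rewrite mark_Def entry_Def; set i := iter _ _ _.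
have [->|_] := eqVneq i D.1; first by rewrite -/(mark D); lia.
by have [->|_] := eqVneq i (ordS D.1); rewrite -/(next D); lia.
Qed.

(** The mark exceeds the next entry by 0 or 1, so half their sum rounds down to [next D] and up to
    [mark D]. *)
Lemma entry_Def_swap D i :
  carries_max D -> entry (Def hn D) i = entry D (tperm D.1 (ordS D.1) i).
Proof.
move=> /(_ (ordS D.1)); rewrite entry_Def -/(next D) => h.
case: tpermP => [->|->|/eqP/negPf-> /eqP/negPf->] //.
  by rewrite eqxx -/(next D); lia.
by rewrite (negPf (ordS_neq hn _)) eqxx -/(mark D); lia.
Qed.

Lemma carries_max_Def D : carries_max D -> carries_max (Def hn D).
Proof.
by move=> h i; rewrite /mark !entry_Def_swap //= tpermR; apply: h.
Qed.

(** Defined on all functions and swapping unconditionally, which makes it injective on a finite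
    type. *)
Definition swap (x : 'I_n * {ffun 'I_n -> 'I_N}) : 'I_n * {ffun 'I_n -> 'I_N} :=
  (ordS x.1, [ffun i => x.2 (tperm x.1 (ordS x.1) i)]).

Lemma swap_inj : injective swap.
Proof.
move=> [k d] [l e] /pair_equal_spec /= [/(@ordS_inj n) <- /ffunP E].
congr pair; apply/ffunP => i.
by have := E (tperm k (ordS k) i); rewrite !ffunE /= tpermK.
Qed.

Lemma carries_max_Per D : carries_max D -> Per (Def hn) D.
Proof.
apply: (Per_inj (h := fun D => (D.1, val D.2)) swap_inj _ carries_max_Def).
  by move=> [k d] [l e] [-> /val_inj ->].
move=> {}D h; congr pair; apply/ffunP => i; apply: val_inj.
by rewrite [in RHS]ffunE; apply: (entry_Def_swap i h).
Qed.

End Differences.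

Section Rhythms.
Variables N n : nat.
Hypothesis hn : 3 <= n.
Implicit Types A : marked_rhythm N n.

Lemma Delta_Ref A : Delta hn (Ref hn A) = Def hn (Delta hn A).
Proof. by congr pair; apply: val_inj; apply: diff_ref; [|apply: valP]. Qed.

(** Reflecting the marked entry between its neighbours exchanges the two differences adjacent to
    it. *)
Definition reflect_at (x : 'I_n * {ffun 'I_n -> 'I_N}) : 'I_n * {ffun 'I_n -> 'I_N} :=
  (ordS x.1, [ffun i => if i == x.1
                        then addm (x.2 (ord_pred x.1)) (subm (x.2 (ordS x.1)) (x.2 x.1))
                        else x.2 i]).

Lemma reflect_at_inj : injective reflect_at.
Proof.
move=> [k a] [l b] /pair_equal_spec /= [/(@ordS_inj n) <- /ffunP E].
have Eneq i : i != k -> a i = b i.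
  by move=> /negPf ik; have := E i; rewrite !ffunE ik.
congr pair; apply/ffunP => i; have [->|/Eneq//] := eqVneq i k.
have := E k; rewrite !ffunE eqxx /=.
rewrite (Eneq (ord_pred k)) ?(Eneq (ordS k)) ?ordS_neq ?ord_pred_neq //.
by move=> /addm_injr /subm_injr.
Qed.

Lemma Ref_reflect A : carries_max (Delta hn A) ->
  ((Ref hn A).1, val (Ref hn A).2) = reflect_at (A.1, val A.2).
Proof.
case: A => k a h; congr pair; apply/ffunP => i; rewrite [RHS]ffunE /=.
case: (eqVneq i k) => [->|/negPf ik]; last by rewrite ffunE ik.
(* The new entry is determined by its difference to the entry before it. *)
rewrite -[LHS](addm_submK (val a (ord_pred k))); congr addm.
(* That difference is an entry of [Def] at the marker, so the swap identifies it with the old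
   [a_(k+1) - a_k]. *)
have := entry_Def_swap hn k h; rewrite /= tpermL -Delta_Ref /entry /= !ffunE.
rewrite ordSK eqxx (negPf (ord_pred_neq hn _)) => e.
exact: val_inj.
Qed.

(** [Delta] transports periodicity forwards but forgets translations, so the converse works with an
    injective map on the rhythms themselves. *)
Lemma quasi_smooth_carries_max A : quasi_smooth hn A <-> carries_max (Delta hn A).
Proof.
split=> [/(Per_conj Delta_Ref)|]; first exact: Per_carries_max.
apply: (Per_inj (P := fun A => carries_max (Delta hn A))
                (h := fun A => (A.1, val A.2)) reflect_at_inj).
- by move=> [k a] [l b] [-> /val_inj ->].
- by move=> B hB; rewrite Delta_Ref; apply: carries_max_Def.
- exact: Ref_reflect.
Qed.

End Rhythms.

Theorem theorem4p1 (N n : nat) (hn : 3 <= n) (hN : n <= N) :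
  (forall D : marked_difference N n,
     Per (Def hn) D <-> (width D <= 1 /\ max_marked D))
  /\
  (forall A : marked_rhythm N n,
     quasi_smooth hn A <->
     (width (Delta hn A) <= 1 /\ max_marked (Delta hn A))).
Proof.
split=> [D|A]; apply: (iff_trans _ (iff_sym (carries_maxP _))).
  by split; [apply: Per_carries_max | apply: carries_max_Per].
exact: quasi_smooth_carries_max.
Qed.
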